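(* Let $n\ge1$ and let $A_1,B_1,A_2,B_2$ be smooth $\mathbb{R}_{0,m}$-valued functions depending only on $\underline{y}$. The function $$F(X)=(\cos z)A_1(\underline{y})+(\sin z)B_1(\underline{y})+(\cos\overline{z})A_2(\underline{y})+(\sin\overline{z})B_2(\underline{y})$$ is left $n$-monogenic (i.e. $\partial_X^nF=0$) if and only if $\Delta^nA_1=0$, $\Delta^nB_1=0$, $$A_2=\sum_{k=1}^n(-1)^kc_k\,\partial_{\underline{y}}^{2k-1}B_1,\qquad B_2=\sum_{k=1}^n(-1)^{k+1}c_k\,\partial_{\underline{y}}^{2k-1}A_1,$$ where $c_1=-\frac12$ and $c_k=-\frac{1}{2^k}\sum_{j=1}^{\lfloor k/2\rfloor}\sum_{i=1}^{j}\binom{k+1}{2j+1}\binom{j}{i}c_{k-i}$ for $k\ge2$.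
   Context: Let $m\ge 2$ and let $\mathbb{R}_{0,m}$ be the real Clifford algebra generated by $e_1,\dots,e_m$ with $e_i^2=-1$ and $e_ie_j=-e_je_i$ for $i\neq j$; all products are Clifford products. Identify $(x_0,\dots,x_m)\in\mathbb{R}^{m+1}$ with $X=x_0+\sum_{j=1}^m x_je_j$, and write $z=x_0+x_1e_1$, $\overline{z}=x_0-x_1e_1$, $\underline{y}=\sum_{j=2}^m x_je_j$. The subalgebra spanned by $1,e_1$ is identified with $\mathbb{C}$ via $i\mapsto e_1$; $\cos,\sin$ are the complex cosine and sine under this identification. Operators: $\partial_X f=\partial_{x_0}f+\sum_{j=1}^m e_j\partial_{x_j}f$, $\partial_{\underline{y}}f=\sum_{j=2}^m e_j\partial_{x_j}f$; powers denote iterated left application. $\Delta=\sum_{j=2}^m\partial_{x_j}^2=-\partial_{\underline{y}}^2$. *)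

(* Defs.v *)
From HB Require Import structures.
From mathcomp Require Import all_boot all_order all_algebra.
From mathcomp Require Import all_classical all_reals all_analysis.
Set Implicit Arguments. Unset Strict Implicit. Unset Printing Implicit Defensive.
Import Order.TTheory GRing.Theory Num.Theory.
Import numFieldNormedType.Exports.
Local Open Scope ring_scope.

Section Clifford.
Variable R : realType.
Variable m : nat.

(* The real Clifford algebra R_{0,m}: an element is a family of real
   coefficients indexed by the basis blades e_A, A a subset of the
   generator indices 'I_m (generator e_(j+1) of the paper is index j). *)
Definition Cl := {ffun {set 'I_m} -> R}.

(* sign of e_A e_B = sgn A B * e_(A Δ B), with e_i^2 = -1 *)
Definition clsgn (A B : {set 'I_m}) : R :=
  (-1) ^+ (#|[set p : 'I_m * 'I_m | (p.1 \in A) && (p.2 \in B) && (p.2 < p.1)%N]|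
           + #|A :&: B|).

Definition clmul (a b : Cl) : Cl :=
  [ffun C => \sum_(A : {set 'I_m}) \sum_(B : {set 'I_m} | (A :|: B) :\: (A :&: B) == C)
              clsgn A B * a A * b B].

Definition clscal (r : R) : Cl := [ffun A => if A == @finset.set0 _ then r else 0].
Definition clgen (j : 'I_m) : Cl := [ffun A => if A == [set j] then 1 else 0].

(* Points X = x_0 + sum_j x_j e_j of R^{m+1}: coordinate 0 is x_0,
   coordinate (lift ord0 j) (= j+1) is the coefficient of generator j. *)
Definition pt := 'rV[R]_(m.+1).
Definition coord (X : pt) (k : 'I_m.+1) : R := X ord0 k.
Definition xi (j : 'I_m) : 'I_m.+1 := lift ord0 j.

Definition partial (k : 'I_m.+1) (f : pt -> Cl) : pt -> Cl :=
  fun X => [ffun A => ('D_(delta_mx 0 k) (fun Y : pt => (f Y A : R^o))) X].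

Definition smooth (f : pt -> Cl) : Prop :=
  forall s : seq 'I_m.+1,
    (forall A, continuous (fun X : pt => (foldr partial f s X A : R^o))) /\
    (forall (k : 'I_m.+1) (X : pt) A,
        derivable (fun Y : pt => (foldr partial f s Y A : R^o)) X (delta_mx 0 k)).

Definition depends_only_on_y (f : pt -> Cl) : Prop :=
  forall X Y : pt, (forall k : 'I_m.+1, (2 <= k)%N -> coord X k = coord Y k) -> f X = f Y.

Definition diracX (f : pt -> Cl) : pt -> Cl :=
  fun X => partial ord0 f X + \sum_(j < m) clmul (clgen j) (partial (xi j) f X).

Definition diracy (f : pt -> Cl) : pt -> Cl :=
  fun X => \sum_(j < m | (0 < j)%N) clmul (clgen j) (partial (xi j) f X).

Definition lapy (f : pt -> Cl) : pt -> Cl :=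
  fun X => \sum_(j < m | (0 < j)%N) partial (xi j) (partial (xi j) f) X.

Definition coshR (t : R) : R := (expR t + expR (- t)) / 2.
Definition sinhR (t : R) : R := (expR t - expR (- t)) / 2.

(* complex cos / sin of z = x0 + x1 e_1 and zbar = x0 - x1 e_1,
   with i identified with e_1 (generator index 0, which exists as 2 <= m). *)
Definition clcplx (h : (0 < m)%N) (a b : R) : Cl :=
  clscal a + b *: clgen (Ordinal h).
Definition cos_z (h : (0 < m)%N) (X : pt) : Cl :=
  let x0 := coord X ord0 in let x1 := coord X (xi (Ordinal h)) in
  clcplx h (cos x0 * coshR x1) (- (sin x0 * sinhR x1)).
Definition sin_z (h : (0 < m)%N) (X : pt) : Cl :=
  let x0 := coord X ord0 in let x1 := coord X (xi (Ordinal h)) in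
  clcplx h (sin x0 * coshR x1) (cos x0 * sinhR x1).
Definition cos_zbar (h : (0 < m)%N) (X : pt) : Cl :=
  let x0 := coord X ord0 in let x1 := coord X (xi (Ordinal h)) in
  clcplx h (cos x0 * coshR x1) (sin x0 * sinhR x1).
Definition sin_zbar (h : (0 < m)%N) (X : pt) : Cl :=
  let x0 := coord X ord0 in let x1 := coord X (xi (Ordinal h)) in
  clcplx h (sin x0 * coshR x1) (- (cos x0 * sinhR x1)).

End Clifford.

(* The constants c_k: ctab k = [:: c_0; c_1; ...; c_k] (c_0 := 0 is a dummy,
   never used), c_1 = -1/2,
   c_k = -1/2^k sum_{j=1}^{floor(k/2)} sum_{i=1}^{j} C(k+1,2j+1) C(j,i) c_{k-i}. *)
Section Coeffs.
Variable R : realType.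
Fixpoint ctab (k : nat) : seq R :=
  match k with
  | 0 => [:: 0]
  | k'.+1 =>
      let s := ctab k' in
      rcons s (if k' == 0%N then - (1 / 2)
               else - ((2 ^+ k'.+1)^-1) *
                 \sum_(1 <= j < (k'.+1)./2.+1) \sum_(1 <= i < j.+1)
                     ('C(k'.+2, j.*2.+1)%:R * 'C(j, i)%:R * nth 0 s (k'.+1 - i)))
  end.
Definition ccoef (k : nat) : R := nth 0 (ctab k) k.
End Coeffs.

(* Main.v *)
(* Moving e_j (j >= 2) across a function of z conjugates the function, so
   [diracX] turns the quadruple (A1, B1, A2, B2) into
     T (A1, B1, A2, B2) = (D A2, D B2, D A1 + 2 B2, D B1 - 2 A2),  D = [diracy],
   and F = 0 only for the zero quadruple; hence F is n-monogenic iff T^n kills it.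
   With U = (A1, B1), V = (A2, B2) and j (a, b) = (b, - a), the map T acts by
   U' = D V, V' = D U + 2 j V, so that T (T - 2 j) = D^2 and T^n w = 0 forces
   D^(2n) w = 0.  Modulo D^(2n) the characteristic equation T^2 - 2 j T = D^2 has
   the roots j (1 -+ sqrt (1 - D^2)), one divisible by D^2 and one invertible.
   The eigenspace of the first root is V = j P(D) U with
   X P(X) = 1 - sqrt (1 - X^2), i.e. P = sum_k (-1)^k c_k X^(2k-1) because
   c_k = - binomial(1/2, k); the component V - j P(D) U along the second root
   must vanish, while on the eigenspace T^n is divisible by D^(2n) = (- Delta)^n. *)
Require Import Defs.
From HB Require Import structures.
From mathcomp Require Import all_boot all_order all_algebra.
From mathcomp Require Import all_classical all_reals all_analysis.
From mathcomp Require Import ring zify.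
Import Order.TTheory GRing.Theory Num.Theory.
Import numFieldNormedType.Exports.
Local Open Scope ring_scope.

(** * The coefficients c_k *)

Section Coefficients.
Set Implicit Arguments. Unset Strict Implicit.
Variable R : realType.
Implicit Types p q r : {poly R}.

Lemma size_ctab k : size (ctab R k) = k.+1.
Proof. by elim: k => //= k IH; rewrite size_rcons IH. Qed.

(** Each stage appends one entry and keeps the earlier ones, so every long enough table agrees on
    entry i. *)
Lemma nth_ctab k i : (i <= k)%N -> nth 0 (ctab R k) i = ccoef R i.
Proof.
elim: k => [|k IH]; first by rewrite leqn0 => /eqP ->.
rewrite leq_eqVlt => /orP[/eqP -> //|]; rewrite ltnS => ik.
by rewrite [ctab _ _]/= nth_rcons size_ctab ltnS ik IH.
Qed.

Lemma ccoef1 : ccoef R 1 = - (1 / 2).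
Proof. by []. Qed.

(** The power of two is cleared to match the factor that [sum_odd_bin] produces in [sqrt_polyP]. *)
Lemma ccoefE k : (2 <= k)%N -> 2 ^+ k * ccoef R k =
  - \sum_(1 <= j < k./2.+1) \sum_(1 <= i < j.+1)
      ('C(k.+1, j.*2.+1)%:R * 'C(j, i)%:R * ccoef R (k - i)).
Proof.
case: k => [|[|k]] // _; set n := k.+2.
rewrite /ccoef /n [ctab _ _]/= -/(ctab R k.+1) nth_rcons size_ctab ltnn eqxx /=.
rewrite mulrA mulrN mulfV ?mulN1r ?expf_neq0 ?pnatr_eq0 //.
congr (- _); apply: eq_bigr => j _; apply: eq_big_nat => i /andP[i0 _].
rewrite -/(ctab R k.+1) nth_ctab //; lia.
Qed.

Lemma dvdXn_coefP n p : reflect (forall i, (i < n)%N -> p`_i = 0) ('X^n %| p).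
Proof.
apply: (iffP idP) => [/Pdiv.Field.dvdpP[q ->] i lt_in|p0].
  by rewrite coefMXn lt_in.
by rewrite -(poly_take_drop n p) (_ : take_poly n p = 0) ?add0r ?dvdp_mull //;
  apply/polyP => i; rewrite coef_take_poly coef0; case: ifP => // /p0.
Qed.

(* The truncation at order N of the power series of sqrt (1 + X). *)
Definition sqrt_poly N : {poly R} := 1 - \sum_(1 <= k < N) ccoef R k *: 'X^k.

Lemma coef0_sqrt_poly N : (sqrt_poly N)`_0 = 1.
Proof.
rewrite coefB coef1 coef_sum big_nat big1 ?subr0 // => k /andP[k0 _].
by rewrite coefZ coefXn eq_sym gtn_eqF ?mulr0.
Qed.

Lemma coef_sqrt_poly N i : (0 < i)%N ->
  (sqrt_poly N)`_i = if (i < N)%N then - ccoef R i else 0.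
Proof.
move=> i0; rewrite coefB coef1 gtn_eqF // sub0r coef_sum.
under eq_bigr do rewrite coefZ coefXn.
case: ifPn => [iN|]; last first.
  rewrite -leqNgt => Ni; rewrite big_nat big1 ?oppr0 // => k /andP[_ kN].
  by rewrite gtn_eqF ?mulr0 // (leq_trans kN).
rewrite (bigD1_seq i) ?mem_index_iota ?i0 ?iota_uniq //= eqxx mulr1 big1 ?addr0 //.
by move=> k ki; rewrite eq_sym (negPf ki) mulr0.
Qed.

Lemma big_ord_double (V : nmodType) n (F : nat -> V) :
  \sum_(i < n.*2) F i = \sum_(j < n) (F j.*2 + F j.*2.+1).
Proof.
elim: n => [|n IH]; first by rewrite !big_ord0.
by rewrite doubleS !big_ord_recr /= IH addrA.
Qed.

(** The range may exceed n + 1 because the extra binomials vanish; an even range can then be split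
    by parity with [big_ord_double]. *)
Lemma binomial_ord (S : comNzRingType) (x y : S) n M : (n < M)%N ->
  (x + y) ^+ n = \sum_(i < M) 'C(n, i)%:R * x ^+ (n - i) * y ^+ i.
Proof.
move=> nM; rewrite exprDn (big_ord_widen M (fun i => x ^+ (n - i) * y ^+ i *+ 'C(n, i)) nM).
rewrite big_mkcond; apply: eq_bigr => i _; rewrite ltnS; case: leqP => [_|/bin_small ->].
  by rewrite -mulrA mulr_natl.
by rewrite !mul0r.
Qed.

(** By Pascal's rule each odd-index entry of row n + 1 is a sum of two neighbours in row n, and
    these pairs exhaust row n. *)
Lemma sum_odd_bin n M : (n < M.*2)%N ->
  \sum_(j < M) 'C(n.+1, j.*2.+1)%:R = 2 ^+ n :> R.
Proof.
move=> nM; rewrite -[2]/(1 + 1) (@binomial_ord _ 1 1 n M.*2) //.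
rewrite (big_ord_double _ (fun i => 'C(n, i)%:R * 1 ^+ (n - i) * 1 ^+ i)).
by apply: eq_bigr => j _; rewrite binS natrD !expr1n !mulr1 addrC.
Qed.

Lemma dvdp_exp2_sub d r a j : d %| r ^+ 2 - a -> d %| r ^+ j.*2 - a ^+ j.
Proof.
by move=> dr; rewrite -muln2 mulnC exprM subrXX dvdp_mulr.
Qed.

(* Modulo X^(N+1), (1 - r)^(N+1) vanishes; the odd part of its binomial expansion
   is minus the sum below, and the even part is a polynomial of degree < N in X. *)
Lemma coef_sqrt_identity N r : (2 <= N)%N -> r`_0 = 1 ->
    'X^(N.+1) %| r ^+ 2 - (1 + 'X) ->
  \sum_(j < N.+2) 'C(N.+1, j.*2.+1)%:R * ((1 + 'X) ^+ j * r)`_N = 0.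
Proof.
move=> N2 r0 rP.
have: ((1 - r) ^+ N.+1)`_N = 0.
  suff /dvdXn_coefP: 'X^(N.+1) %| (1 - r) ^+ N.+1 by apply.
  rewrite dvdp_exp2r //.
  by rewrite -['X]expr1; apply/dvdXn_coefP => -[|//] _; rewrite coefB coef1 r0 subrr.
have eqmod q1 q2 : 'X^(N.+1) %| q1 - q2 -> q1`_N = q2`_N.
  by move=> /dvdXn_coefP/(_ N (ltnSn N))/eqP; rewrite coefB subr_eq0 => /eqP.
rewrite (@binomial_ord _ 1 (- r) _ N.+2.*2); last by lia.
rewrite (big_ord_double _ (fun i => 'C(N.+1, i)%:R * 1 ^+ (N.+1 - i) * (- r) ^+ i)).
rewrite big_split /= coefD !coef_sum big1 ?add0r => [|j _]; last first.
  rewrite expr1n mulr1 mulr_natl coefMn.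
  have [lt|ge] := ltnP N.+1 j.*2; first by rewrite bin_small.
  rewrite exprNn -signr_odd odd_double mul1r.
  rewrite (eqmod _ _ (dvdp_exp2_sub j rP)) nth_default ?mul0rn //.
  rewrite (leq_trans (size_exp_leq _ _)) // addrC -[1]/(1%:P) size_XaddC /=; lia.
move/(congr1 -%R); rewrite oppr0 -sumrN; apply: etrans; apply: eq_bigr => j _.
rewrite expr1n mulr1 !mulr_natl coefMn exprS exprNn -signr_odd odd_double mul1r.
rewrite mulNr coefN mulNrn opprK; congr (_ *+ _); apply/esym/eqmod.
by rewrite [r * _]mulrC -mulrBl dvdp_mulr // dvdp_exp2_sub.
Qed.

Lemma coef_1DX_expM r j n : (j <= n)%N ->
  ((1 + 'X) ^+ j * r)`_n = \sum_(0 <= i < j.+1) 'C(j, i)%:R * r`_(n - i).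
Proof.
move=> jn; rewrite exprDn mulr_suml coef_sum big_mkord; apply: eq_bigr => i _.
rewrite mulr_natl expr1n mul1r mulrnAl coefMn coefXnM ltnNge.
by rewrite (leq_trans _ jn) // -ltnS.
Qed.

(** Induction on N: a multiple of X^N corrects [sqrt_poly N] to the next order, and
    [coef_sqrt_identity] with the recurrence shows that its coefficient is - c_N. *)
Lemma sqrt_polyP N : (2 <= N)%N -> 'X^N %| sqrt_poly N ^+ 2 - (1 + 'X).
Proof.
elim: N => // N IH; rewrite leq_eqVlt => /orP[/eqP <-|].
  rewrite /sqrt_poly big_nat1 ccoef1 scaleNr opprK -mul_polyC.
  have h2 : 2 * (1 / 2)%:P = 1 :> {poly R}.
    by rewrite mulr_natl -polyCMn -[_ *+ 2]mulr_natl mul1r mulfV ?pnatr_eq0.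
  rewrite (_ : _ - _ = (1 / 2)%:P ^+ 2 * 'X^2 + (2 * (1 / 2)%:P - 1) * 'X); last by ring.
  by rewrite h2 subrr mul0r addr0 dvdp_mull.
rewrite ltnS => N2; set r := sqrt_poly N.
have /Pdiv.Field.dvdpP[q qE] : 'X^N %| r ^+ 2 - (1 + 'X) by exact: IH.
(* This d cancels the constant term of q + 2 d r + d^2 X^N, since r has constant term 1. *)
pose d := - (q`_0 / 2); pose r' := r + d *: 'X^N.
have r'P : 'X^(N.+1) %| r' ^+ 2 - (1 + 'X).
  rewrite (_ : _ - _ = (q + 2 * d%:P * r + d%:P ^+ 2 * 'X^N) * 'X^N); last first.
    rewrite /r' -mul_polyC.
    transitivity (r ^+ 2 - (1 + 'X) + (2 * d%:P * r + d%:P ^+ 2 * 'X^N) * 'X^N); first by ring.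
    by rewrite qE; ring.
  rewrite exprS dvdp_mul // -['X]expr1; apply/dvdXn_coefP => -[|//] _.
  rewrite !coefD coefMXn (ltn_trans _ N2) // addr0 -(mulrA 2) mulr_natl coefMn coefCM.
  by rewrite coef0_sqrt_poly /d; field.
have r'0 : r'`_0 = 1.
  by rewrite coefD coefZ coefXn ltn_eqF ?(ltn_trans _ N2) // mulr0 addr0 coef0_sqrt_poly.
have := coef_sqrt_identity N2 r'0 r'P.
have r'E i : (0 < i <= N)%N -> r'`_i = if (i < N)%N then - ccoef R i else d.
  move=> /andP[i0 iN]; rewrite coefD coefZ coefXn coef_sqrt_poly //.
  case: ltnP => Ni; first by rewrite ltn_eqF // mulr0 addr0.
  by rewrite eqn_leq iN Ni mulr1 add0r.
(* Only i = 0 reaches the new coefficient d; for 1 <= i <= j the index N - i lies strictly between 0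
   and N. *)
have lin j : (j <= N./2)%N -> ((1 + 'X) ^+ j * r')`_N =
    d - \sum_(1 <= i < j.+1) 'C(j, i)%:R * ccoef R (N - i).
  move=> jN; rewrite coef_1DX_expM; last by lia.
  rewrite big_ltn // subn0 bin0 mul1r r'E ?ltnn ?leqnn ?andbT; last by lia.
  rewrite -sumrN; congr (_ + _); apply: eq_big_nat => i ij.
  by rewrite r'E; [rewrite ifT ?mulrN //; lia|lia].
pose G j := 'C(N.+1, j.*2.+1)%:R * ((1 + 'X) ^+ j * r')`_N.
(* The binomials vanish once 2 j > N, which leaves the range of the recurrence. *)
rewrite -(big_mkord xpredT G) (@big_cat_nat _ _ _ (N./2.+1)) //=; last by lia.
rewrite [X in _ + X]big_nat [X in _ + X]big1 ?addr0 => [|j Nj]; last first.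
  by rewrite /G bin_small ?mul0r //; lia.
pose H j := 'C(N.+1, j.*2.+1)%:R * d
  - \sum_(1 <= i < j.+1) 'C(N.+1, j.*2.+1)%:R * 'C(j, i)%:R * ccoef R (N - i).
have -> : \sum_(0 <= j < N./2.+1) G j = \sum_(0 <= j < N./2.+1) H j.
  apply: eq_big_nat => j jN; rewrite /G lin // /H mulrBr; congr (_ - _).
  by rewrite mulr_sumr; apply: eq_bigr => i _; rewrite mulrA.
(* The terms in d add up to 2^N d; the inner sum for j = 0 is empty, so the outer one starts at 1 as
   in [ccoefE]. *)
rewrite sumrB -mulr_suml {1}big_mkord sum_odd_bin; last by lia.
rewrite [X in _ - X]big_ltn // [\sum_(1 <= i < 1) _]big_geq // add0r => dE.
have cE := ccoefE N2.
have {dE cE} dE : d = - ccoef R N.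
  have n2 : (2 : R) != 0 by rewrite pnatr_eq0.
  by apply: (mulfI (expf_neq0 N n2)); rewrite [RHS]mulrN cE opprK; apply/subr0_eq.
move: r'P; congr ('X^_ %| _ ^+ 2 - _).
by rewrite /r' dE /r /sqrt_poly [in RHS]big_nat_recr ?(ltnW N2) //= opprD addrA scaleNr.
Qed.

(* (1 - sqrt (1 - X^2)) / X up to order 2n. *)
Definition slope_poly n : {poly R} :=
  \sum_(1 <= k < n.+1) ((-1) ^+ k * ccoef R k) *: 'X^(k.*2.-1).

(** The factor X turns X^(2k-1) into X^(2k), and (-1)^k X^(2k) = (- X^2)^k. *)
Lemma mulX_slope_poly n :
  1 - 'X * slope_poly n = sqrt_poly n.+1 \Po (- 'X^2).
Proof.
rewrite /sqrt_poly comp_polyB -[1 in RHS]/(1%:P) comp_polyC; congr (_ - _).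
rewrite /slope_poly mulr_sumr linear_sum; apply: eq_big_nat => k /andP[k0 _].
rewrite linearZ /= comp_Xn_poly [in RHS]exprNn -scalerAr -exprS prednK ?double_gt0 //.
rewrite -exprM mul2n mulrC -scalerA -signr_odd -[in RHS]signr_odd.
by case: odd; rewrite ?expr0 ?expr1 ?scale1r ?mul1r // scaleN1r mulN1r.
Qed.

(** Multiplied by X, the right-hand side is (1 - X P)^2 - (1 - X^2), to which [sqrt_polyP] applies
    at - X^2 with exponent 2n + 2; this leaves room for the extra factor X. *)
Lemma slope_polyP n : (0 < n)%N ->
  'X^(n.*2) %| 'X - 2 * slope_poly n + slope_poly n ^+ 2 * 'X.
Proof.
move=> n0; set P := slope_poly n.
have /Pdiv.Field.dvdpP[q qE] := @sqrt_polyP n.+1 n0.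
have := congr1 (fun p => p \Po (- 'X^2)) qE.
rewrite comp_polyB comp_polyD rmorphXn /= -mulX_slope_poly -/P.
rewrite -[1 in X in _ - (X + _)]/(1%:P) comp_polyC comp_polyX comp_polyM comp_Xn_poly => H.
have X0 : 'X != 0 :> {poly R} by rewrite polyX_eq0.
rewrite -(dvdp_mul2r _ _ X0).
have -> : ('X - 2 * P + P ^+ 2 * 'X) * 'X = (1 - 'X * P) ^+ 2 - (1 - 'X^2) by ring.
rewrite H dvdp_mull // exprNn dvdp_mull // -exprM -exprSr dvdp_exp2l //; lia.
Qed.

End Coefficients.

(** * The linear system *)

Section PolynomialAction.
Set Implicit Arguments. Unset Strict Implicit.
Variables (K : fieldType) (V : lmodType K) (D : {linear V -> V}).
Implicit Types (p q : {poly K}) (v : V).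

(** The operator p(D): V becomes a module over K[X], where divisibility and Bezout identities can be
    used. *)
Definition polyact p v := \sum_(i < size p) p`_i *: iter i D v.

Lemma polyact_widen n p v : (size p <= n)%N ->
  polyact p v = \sum_(i < n) p`_i *: iter i D v.
Proof.
move=> pn; rewrite /polyact (big_ord_widen n (fun i => p`_i *: iter i D v) pn).
rewrite big_mkcond; apply: eq_bigr => i _; case: ltnP => // pi.
by rewrite nth_default ?scale0r.
Qed.

Fact iter_linear n : linear (iter n D).
Proof. by elim: n => // n IH a u v /=; rewrite IH linearP. Qed.

Lemma iter_linear0 n : iter n D 0 = 0.
Proof. by elim: n => //= n ->; rewrite linear0. Qed.

Lemma iter_linearZ n (c : K) v : iter n D (c *: v) = c *: iter n D v.
Proof. by rewrite -[c *: v]addr0 iter_linear iter_linear0 addr0. Qed.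

Fact polyact_is_linear p : linear (polyact p).
Proof.
move=> a u v; rewrite /polyact scaler_sumr -big_split; apply: eq_bigr => i _ /=.
by rewrite iter_linear scalerDr !scalerA mulrC.
Qed.
HB.instance Definition _ p :=
  GRing.isLinear.Build K V V *:%R (polyact p) (polyact_is_linear p).

Lemma polyactDl p q v : polyact (p + q) v = polyact p v + polyact q v.
Proof.
pose n := maxn (size p) (size q).
rewrite !(@polyact_widen n) ?leq_maxl ?leq_maxr ?size_polyD // -big_split /=.
by apply: eq_bigr => i _; rewrite coefD scalerDl.
Qed.

Lemma polyactZl a p v : polyact (a *: p) v = a *: polyact p v.
Proof.
rewrite (@polyact_widen (size p)) ?size_scale_leq // scaler_sumr.
by apply: eq_bigr => i _; rewrite coefZ scalerA.
Qed.

Lemma polyact0l v : polyact 0 v = 0.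
Proof. by rewrite /polyact size_poly0 big_ord0. Qed.

Lemma polyact_suml I (r : seq I) (P : pred I) (F : I -> {poly K}) v :
  polyact (\sum_(i <- r | P i) F i) v = \sum_(i <- r | P i) polyact (F i) v.
Proof.
by elim/big_rec2: _ => [|i p q _ <-]; rewrite ?polyact0l ?polyactDl.
Qed.

Lemma polyactXn n v : polyact 'X^n v = iter n D v.
Proof.
rewrite /polyact size_polyXn big_ord_recr /= coefXn eqxx scale1r big1 ?add0r //.
by move=> i _; rewrite coefXn ltn_eqF ?scale0r.
Qed.

Lemma polyactX v : polyact 'X v = D v.
Proof. by rewrite -['X]expr1 polyactXn. Qed.

Lemma polyact1 v : polyact 1 v = v.
Proof. by rewrite -(expr0 'X) polyactXn. Qed.

Lemma polyactM p q v : polyact (p * q) v = polyact p (polyact q v).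
Proof.
elim/poly_ind: p => [|p c IH]; first by rewrite mul0r !polyact0l.
have mulX r u : polyact ('X * r) u = D (polyact r u).
  rewrite (@polyact_widen (size r).+1); last first.
    by rewrite mulrC; apply: (leq_trans (size_polyMleq _ _)); rewrite size_polyX addn2.
  rewrite big_ord_recl coefXM /= scale0r add0r linear_sum.
  by apply: eq_bigr => i _; rewrite coefXM /= linearZ.
rewrite mulrDl !polyactDl [p * 'X]mulrC -mulrA !mulX IH; congr (_ + _).
by rewrite mul_polyC polyactZl -alg_polyC polyactZl polyact1.
Qed.

Lemma dvdp_polyact p q v : p %| q -> polyact p v = 0 -> polyact q v = 0.
Proof. by move=> /Pdiv.Field.dvdpP[r ->] pv; rewrite polyactM pv linear0. Qed.

(** A Bezout identity a p + b q = 1 recovers v from p(D) v and q(D) v. *)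
Lemma coprimep_polyact p q v :
  coprimep p q -> polyact p v = 0 -> polyact q v = 0 -> v = 0.
Proof.
move=> /Bezout_eq1_coprimepP[[a b] /= ab1] pv qv.
by rewrite -[v]polyact1 -ab1 polyactDl !polyactM pv qv !linear0 addr0.
Qed.

End PolynomialAction.

(** * Quadruples killed by a power of the step operator T *)

Section NilpotentSystem.
Set Implicit Arguments. Unset Strict Implicit.
Variables (K : numFieldType) (V : lmodType K) (D : {linear V -> V}).

Definition quad := (V * V * V * V)%type.
Definition quad_step (w : quad) : quad :=
  let: (a1, b1, a2, b2) := w in (D a2, D b2, D a1 + 2 *: b2, D b1 - 2 *: a2).

(* With j (a1, b1, a2, b2) = (b1, - a1, b2, - a2), T = quad_step satisfies
   (T - 2 j) T = D^2. *)
Lemma iter_quad_step0_nil n a1 b1 a2 b2 :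
    iter n quad_step (a1, b1, a2, b2) = (0, 0, 0, 0) ->
  [/\ iter n.*2 D a1 = 0, iter n.*2 D b1 = 0, iter n.*2 D a2 = 0 & iter n.*2 D b2 = 0].
Proof.
elim: n a1 b1 a2 b2 => [|n IH] a1 b1 a2 b2; first by case.
rewrite iterSr => /IH[]; rewrite doubleS /=; set i := iter n.*2 D.
have iD v : i (D v) = D (i v) by rewrite /i -iterSr.
have iP c u v : i (c *: u + v) = c *: i u + i v by exact: iter_linear.
rewrite !iD -scaleNr ![_ + _ *: _]addrC !iP !iD => Da2 Db2.
(* One more application of D makes the cross term vanish, since D^(2n+1) already kills b2; the next
   line does the same with a2. *)
move=> /(congr1 D); rewrite linearP linear0 Db2 scaler0 add0r => ->.
by move=> /(congr1 D); rewrite linearP linear0 Da2 scaler0 add0r => ->; rewrite linear0.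
Qed.

Variables (n : nat) (P : {poly K}).
Hypotheses (n_gt0 : (0 < n)%N) (PP : 'X^(n.*2) %| 'X - 2 * P + P ^+ 2 * 'X).

(** At 0 the hypothesis [PP] reduces to - 2 P(0) = 0. Hence X^2 divides X P, the source of the two
    powers of D gained per step in the converse direction. *)
Let root_slope : P.[0] = 0.
Proof.
have : root ('X - 2 * P + P ^+ 2 * 'X) 0.
  rewrite root_factor_theorem subr0; apply: dvdp_trans PP.
  by rewrite -[X in X %| _]expr1 dvdp_exp2l // double_gt0.
rewrite rootE !hornerE oppr_eq0 mulf_eq0.
by rewrite -(natrD _ 1 1) pnatr_eq0 => /eqP.
Qed.

(* The two components of V - j P(D) U. *)
Definition lag1 (w : quad) := let: (a1, b1, a2, b2) := w in a2 - polyact D P b1.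
Definition lag2 (w : quad) := let: (a1, b1, a2, b2) := w in b2 + polyact D P a1.

(** On vectors killed by D^(2n), [PP] reads X = (2 - X P) P. Thus T exchanges the two lags up to
    sign and applies 2 - X P, the factor that corresponds to 1 + sqrt (1 - X^2). *)
Lemma lag_step w : let: (a1, b1, _, _) := w in
    iter n.*2 D a1 = 0 -> iter n.*2 D b1 = 0 ->
  lag1 (quad_step w) = polyact D (2 - 'X * P) (lag2 w) /\
  lag2 (quad_step w) = - polyact D (2 - 'X * P) (lag1 w).
Proof.
case: w => [[[a1 b1] a2] b2] a1N b1N.
have XE v : iter n.*2 D v = 0 -> D v = polyact D (2 - 'X * P) (polyact D P v).
  move=> v0; rewrite -polyactX -polyactM.
  have {1}-> : 'X = ('X - 2 * P + P ^+ 2 * 'X) + (2 - 'X * P) * P :> {poly K} by ring.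
  by rewrite polyactDl (dvdp_polyact PP) ?polyactXn // add0r.
have QE v : polyact D (2 - 'X * P) v = 2 *: v - polyact D P (D v).
  rewrite -[D v]polyactX -polyactM ['X * _]mulrC polyactDl -[- (P * 'X)]scaleN1r polyactZl scaleN1r.
  by rewrite -(scaler_nat 2 (1 : {poly K})) polyactZl polyact1.
split=> /=.
  rewrite XE // linearD /= [in RHS]QE.
  by rewrite -addrA addrC.
rewrite XE // raddfB /= [polyact _ _ a2]QE.
by rewrite !opprB addrA addrAC.
Qed.

(** The constant term of 2 - X P is 2, so this polynomial is coprime to X^(2n). *)
Let lag_inj v : iter n.*2 D v = 0 -> polyact D (2 - 'X * P) v = 0 -> v = 0.
Proof.
rewrite -polyactXn; apply: coprimep_polyact; rewrite coprimep_expl // coprimep_sym.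
rewrite -[X in coprimep _ X]subr0 -[0]polyC0 coprimep_XsubC rootE !hornerE.
by rewrite subr0 -(natrD _ 1 1) pnatr_eq0.
Qed.

Lemma quad_step_nilpotent a1 b1 a2 b2 :
  iter n quad_step (a1, b1, a2, b2) = (0, 0, 0, 0) <->
  [/\ iter n.*2 D a1 = 0, iter n.*2 D b1 = 0,
      a2 = polyact D P b1 & b2 = - polyact D P a1].
Proof.
split=> [wn|[a1N b1N a2E b2E]].
  have [a1N b1N a2N b2N] := iter_quad_step0_nil wn.
  have {wn} : lag1 (iter n quad_step (a1, b1, a2, b2)) = 0 /\
         lag2 (iter n quad_step (a1, b1, a2, b2)) = 0.
    by rewrite wn /= !linear0 addr0.
  (* Descent on the number m of steps, with the exponent 2n fixed: [lag_step] and [lag_inj] carry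
     the vanishing of the lags back from T w to w. *)
  suff lagN m (w : quad) : let: (a1, b1, a2, b2) := w in
      [/\ iter n.*2 D a1 = 0, iter n.*2 D b1 = 0, iter n.*2 D a2 = 0 & iter n.*2 D b2 = 0] ->
      lag1 (iter m quad_step w) = 0 /\ lag2 (iter m quad_step w) = 0 ->
      lag1 w = 0 /\ lag2 w = 0.
    move=> /(lagN n (a1, b1, a2, b2)) /= [//|/eqP + /eqP].
    by rewrite subr_eq0 addr_eq0 => /eqP -> /eqP ->.
  elim: m w => [|m IH] [[[u1 v1] u2] v2] // [u1N v1N u2N v2N].
  have N_lin c u v : iter n.*2 D u = 0 -> iter n.*2 D v = 0 -> iter n.*2 D (u + c *: v) = 0.
    by move=> u0 v0; rewrite addrC iter_linear u0 v0 scaler0 addr0.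
  have ND u : iter n.*2 D u = 0 -> iter n.*2 D (D u) = 0.
    by rewrite -iterSr /= => ->; rewrite linear0.
  rewrite iterSr => /(IH (quad_step (u1, v1, u2, v2))).
  have NP u : iter n.*2 D u = 0 -> iter n.*2 D (polyact D P u) = 0.
    by move=> u0; rewrite -polyactXn -polyactM mulrC polyactM polyactXn u0 linear0.
  have [-> ->] := @lag_step (u1, v1, u2, v2) u1N v1N.
  case.
    split; [exact: ND|exact: ND|apply: N_lin => //; exact: ND|].
    by rewrite -scaleNr; apply: N_lin => //; exact: ND.
  move=> /lag_inj e2 /eqP; rewrite oppr_eq0 => /eqP/lag_inj e1; split.
    by apply: e1; rewrite /= -scaleN1r N_lin // NP.
  by apply: e2; rewrite /= -[polyact _ _ _]scale1r N_lin // NP.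
have [s Ps] : exists s, P = 'X * s.
  have /Pdiv.Field.dvdpP[s ->] : 'X %| P by rewrite -['X]subr0 dvdp_XsubCl rootE root_slope.
  by exists s; rewrite mulrC.
(* Here the exponent drops with m: when the lags vanish, T w starts with D P b1 and - D P a1, and
   X^2 divides X P. The bound m <= n keeps [lag_step] applicable. *)
suff zero m (w : quad) : let: (a1, b1, _, _) := w in (m <= n)%N ->
    [/\ iter m.*2 D a1 = 0, iter m.*2 D b1 = 0, lag1 w = 0 & lag2 w = 0] ->
    iter m quad_step w = (0, 0, 0, 0).
  by apply: (zero n (a1, b1, a2, b2)) => //; rewrite /= a2E b2E subrr addNr.
elim: m w => [|m IH] [[[u1 v1] u2] v2] mn [u1N v1N /eqP + /eqP].
  rewrite /= in u1N v1N *.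
  by rewrite u1N v1N !linear0 !addr0 => /eqP -> /eqP ->.
rewrite /= subr_eq0 addr_eq0 => /eqP u2E /eqP v2E.
rewrite -iterS iterSr.
apply: (IH (D u2, D v2, D u1 + 2 *: v2, D v1 - 2 *: u2)); first exact: ltnW.
have weaken u : iter m.+1.*2 D u = 0 -> iter n.*2 D u = 0.
  move=> u0; rewrite -(subnK mn) doubleD iterD u0; exact: iter_linear0.
rewrite -/(quad_step (u1, v1, u2, v2)).
have [-> ->] := @lag_step (u1, v1, u2, v2) (weaken _ u1N) (weaken _ v1N).
rewrite /= u2E v2E subrr addNr !linear0.
have ND u : iter m.+1.*2 D u = 0 -> iter m.*2 D (D (polyact D P u)) = 0.
  move=> u0; rewrite -[D (polyact _ _ _)]polyactX -polyactXn -!polyactM Ps.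
  have -> : 'X^(m.*2) * 'X * ('X * s) = s * 'X^(m.*2.+2) by rewrite !exprS; ring.
  by rewrite polyactM polyactXn -doubleS u0 linear0.
by rewrite !linearN -scaleN1r -[_ *: _]addr0 iter_linear iter_linear0 !ND // scaler0 addr0.
Qed.

End NilpotentSystem.

(** * Left multiplication by generators *)

Section CliffordProduct.
Set Implicit Arguments. Unset Strict Implicit.
Variables (R : realType) (m : nat).
Implicit Types (x y a : Cl R m) (i j : 'I_m) (A B C : {set 'I_m}).

(** Spelled as the index condition of [clmul], so that it can be folded there. *)
Definition symd A B := (A :|: B) :\: (A :&: B).

Lemma in_symd A B i : (i \in symd A B) = (i \in A) (+) (i \in B).
Proof. by rewrite !inE; case: (_ \in A); case: (_ \in B). Qed.

Lemma symdK A B : symd A (symd A B) = B.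
Proof. by apply/setP => i; rewrite !in_symd addKb. Qed.

Lemma symdCA A B C : symd A (symd B C) = symd B (symd A C).
Proof. by apply/setP => i; rewrite !in_symd addbCA. Qed.

Lemma symd_eq A B C : (symd A B == C) = (B == symd A C).
Proof. by apply/eqP/eqP => [<-|->]; rewrite symdK. Qed.

(** The sign of e_j e_B. Indices below j count transpositions and j itself contributes e_j^2 = -1,
    hence the non-strict comparison. *)
Definition gen_sign j B : R := \prod_(b in B) (-1) ^+ (b <= j)%N.

Lemma clsgn_gen j B : clsgn R [set j] B = gen_sign j B.
Proof.
rewrite /clsgn /gen_sign prodrXr; congr (_ ^+ _).
have -> : [set p : 'I_m * 'I_m | (p.1 \in [set j]) && (p.2 \in B) && (p.2 < p.1)%N]
    = (fun b => (j, b)) @: [set b in B | (b < j)%N].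
  apply/setP => -[p1 p2]; apply/idP/imsetP => /= [|[b + [-> ->]]].
    rewrite !inE /= => /andP[/andP[/eqP -> p2B] lt].
    by exists p2; rewrite ?inE ?p2B.
  by rewrite !inE /= eqxx.
rewrite card_imset => [|b c []] //.
have -> : [set j] :&: B = [set b in B | b == j].
  by apply/setP => b; rewrite !inE andbC.
rewrite -!sum1dep_card !big_mkcondr -big_split /=; apply: eq_bigr => b _.
by rewrite -val_eqE /=; case: ltngtP.
Qed.

(** Toggling i affects only the factor of the product at i. *)
Lemma gen_sign_symd i j B :
  gen_sign j (symd [set i] B) = (-1) ^+ (i <= j)%N * gen_sign j B.
Proof.
rewrite /gen_sign big_mkcond [in RHS]big_mkcond (bigD1 i) //= [in RHS](bigD1 i) //=.
rewrite mulrA in_symd set11 /=; congr (_ * _).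
  by case: (i \in B) => /=; rewrite ?mulr1 // -expr2 sqrr_sign.
by apply: eq_bigr => b bi; rewrite in_symd inE (negPf bi).
Qed.

(** For given A and C, the only contributing B is the symmetric difference of A and C. *)
Lemma clmulE a x C : clmul a x C =
  \sum_A clsgn R A (symd A C) * a A * x (symd A C).
Proof.
rewrite ffunE; apply: eq_bigr => A _.
by under eq_bigl do rewrite -/(symd A _) symd_eq; rewrite big_pred1_eq.
Qed.

Fact clmul_is_linear a : linear (clmul a).
Proof.
move=> c x y; apply/ffunP => C; rewrite [LHS]clmulE [RHS]ffunE ffunE !clmulE.
rewrite scaler_sumr -big_split; apply: eq_bigr => A _ /=.
by rewrite !ffunE mulrDr; congr (_ + _); rewrite [LHS]mulrCA.
Qed.
HB.instance Definition _ a :=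
  GRing.isLinear.Build R (Cl R m) (Cl R m) *:%R (clmul a) (clmul_is_linear a).

Lemma clmulDl a b x : clmul (a + b) x = clmul a x + clmul b x.
Proof.
apply/ffunP => C; rewrite [RHS]ffunE !clmulE -big_split; apply: eq_bigr => A _ /=.
by rewrite ffunE mulrDr mulrDl.
Qed.

Lemma clmulZl c a x : clmul (c *: a) x = c *: clmul a x.
Proof.
apply/ffunP => C; rewrite [RHS]ffunE !clmulE scaler_sumr; apply: eq_bigr => A _ /=.
by rewrite ffunE -!mulrA [LHS]mulrCA.
Qed.

Lemma clmul_clscal c x : clmul (clscal m c) x = c *: x.
Proof.
apply/ffunP => C; rewrite clmulE (bigD1 finset.set0) //= big1 => [|A /negPf A0].
  have -> : symd finset.set0 C = C by apply/setP => i; rewrite in_symd inE.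
  rewrite [clscal _ _ _]ffunE eqxx addr0 [RHS]ffunE (_ : clsgn _ _ _ = 1) ?mul1r //.
  by rewrite /clsgn finset.set0I cards0 addn0 eq_card0 // => p; rewrite !inE.
by rewrite [clscal _ _ _]ffunE A0 mulr0 mul0r.
Qed.

Definition gen_act j : Cl R m -> Cl R m := clmul (clgen R j).
HB.instance Definition _ j := GRing.Linear.on (gen_act j).

Lemma gen_actE j x C : gen_act j x C = gen_sign j (symd [set j] C) * x (symd [set j] C).
Proof.
rewrite /gen_act clmulE (bigD1 [set j]) //= big1 => [|A /negPf Aj].
  by rewrite ffunE eqxx mulr1 addr0 clsgn_gen.
by rewrite ffunE Aj mulr0 mul0r.
Qed.

Lemma gen_actK j x : gen_act j (gen_act j x) = - x.
Proof.
apply/ffunP => C; rewrite !gen_actE symdK [RHS]ffunE gen_sign_symd leqnn expr1 mulN1r.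
rewrite mulNr mulrA -[_ * _ in X in - (X * _)]expr2 /gen_sign.
by rewrite -prodrXl big1 ?mul1r // => b _; rewrite sqrr_sign.
Qed.

(** The two orders differ by the signs attached to i <= j and j <= i, which are opposite for
    distinct indices. *)
Lemma gen_actC i j x : i != j -> gen_act i (gen_act j x) = - gen_act j (gen_act i x).
Proof.
move=> ij; apply/ffunP => C; rewrite [RHS]ffunE !gen_actE !gen_sign_symd !leqnn symdCA !expr1.
set si := gen_sign i C; set sj := gen_sign j C.
have : (-1) ^+ (i <= j)%N = - (-1) ^+ (j <= i)%N :> R.
  have : (i != j :> nat) by [].
  by case: ltngtP => // _ _; rewrite ?expr0 ?expr1 ?opprK.
by move=> ->; ring.
Qed.

Lemma clmul_clcplx (h : (0 < m)%N) (a b : R) x :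
  clmul (clcplx h a b) x = a *: x + b *: gen_act (Ordinal h) x.
Proof. by rewrite clmulDl clmulZl clmul_clscal. Qed.

End CliffordProduct.

(** * Derivatives *)

Section MixedDerivatives.
Set Implicit Arguments. Unset Strict Implicit.
Local Open Scope classical_set_scope.
Variables (R : realType) (V : normedModType R).
Implicit Types (f : V -> R^o) (u v x : V).

Lemma derive_line f v x (t : R) :
  'D_1 (fun s : R => f (s *: v + x)) t = 'D_v f (t *: v + x).
Proof.
congr (lim (_ @ 0^')); apply/funext => h /=.
by rewrite [_%:A]mulr1 scalerDl addrA.
Qed.

Lemma derivable_line f v x (t : R) :
  derivable f (t *: v + x) v -> derivable (fun s : R => f (s *: v + x)) t 1.
Proof.
rewrite /derivable; set g1 := fun h => h^-1 *: _; set g2 := fun h => h^-1 *: _.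
suff -> : g1 = g2 by [].
by apply/funext => h; rewrite /g1 /g2 /= [_%:A]mulr1 scalerDl addrA.
Qed.

Lemma is_derive_line f v x (t : R) : derivable f (t *: v + x) v ->
  is_derive t 1 (fun s : R => f (s *: v + x)) ('D_v f (t *: v + x)).
Proof.
by move=> /derivable_line df; rewrite -derive_line; apply: DeriveDef.
Qed.

Lemma is_derive_shift f v x y : derivable f (x + y) v ->
  is_derive y v (fun z => f (x + z)) ('D_v f (x + y)).
Proof.
have E : (fun h => h^-1 *: (f (x + (h *: v + y)) - f (x + y))) =
         (fun h => h^-1 *: (f (h *: v + (x + y)) - f (x + y))).
  by apply/funext => h; rewrite addrCA.
by move=> df; split; [rewrite /derivable /= E|rewrite /derive /= E].
Qed.

Lemma MVT_line f v x (h : R) : 0 < h -> (forall y, derivable f y v) ->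
  exists2 c, 0 < c < h & f (h *: v + x) - f x = 'D_v f (c *: v + x) * h.
Proof.
move=> h0 df.
have dg (t : R) : is_derive t 1 (fun s : R => f (s *: v + x)) ('D_v f (t *: v + x)).
  exact: is_derive_line.
have [|c ci] := MVT h0 (fun t _ => dg t).
  by apply: derivable_within_continuous => t _; exact: ex_derive.
by rewrite scale0r add0r subr0 => ?; exists c.
Qed.

(** The mean value theorem is used twice: along u for y |-> f (h v + y) - f y, then along v for the
    derivative of f along u. *)
Lemma second_difference f u v x (h : R) : 0 < h ->
    (forall y, derivable f y u) -> (forall y, derivable ('D_u f) y v) ->
  exists s t, [/\ 0 < s < h, 0 < t < h &
    f (h *: u + (h *: v + x)) - f (h *: v + x) - (f (h *: u + x) - f x)
      = 'D_v ('D_u f) (t *: v + (s *: u + x)) * h * h].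
Proof.
move=> h0 dfu dfv.
pose g y := f (h *: v + y) - f y.
have g' y : is_derive y u g ('D_u f (h *: v + y) - 'D_u f y).
  apply: is_deriveB; last exact: derivableP.
  exact: is_derive_shift.
have [|s sh gE] := @MVT_line g u x h h0.
  by move=> y; exact: ex_derive.
have [t th tE] := @MVT_line ('D_u f) v (s *: u + x) h h0 dfv.
exists s, t; split=> //.
rewrite -tE -[LHS]/(f _ - f _ - _).
move: gE; rewrite derive_val /g => <-.
by rewrite [h *: v + (h *: u + x)]addrCA; ring.
Qed.

Lemma dist_lt_double (p q r e : R) : `|p - r| < e -> `|q - r| < e -> `|p - q| < e + e.
Proof. by rewrite (distrC q) => pr rq; rewrite (le_lt_trans (ler_distD r p q)) // ltrD. Qed.

(** Schwarz's theorem: one second difference over a small parallelogram is h^2 times either mixed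
    derivative at a point near x, and both are continuous at x. *)
Lemma derive_comm f u v x :
    (forall y, derivable f y u) -> (forall y, derivable f y v) ->
    (forall y, derivable ('D_u f) y v) -> (forall y, derivable ('D_v f) y u) ->
    {for x, continuous ('D_v ('D_u f))} -> {for x, continuous ('D_u ('D_v f))} ->
  'D_v ('D_u f) x = 'D_u ('D_v f) x.
Proof.
move=> dfu dfv dfuv dfvu cuv cvu; apply/eqP/negPn/negP => neq.
set a := 'D_v _ x in neq; set b := 'D_u _ x in neq.
(* Half the gap: no number is within e of both a and b. *)
pose e := `|a - b| / 2.
have e0 : 0 < e by rewrite divr_gt0 // normr_gt0 subr_eq0.
have near1 : \forall y \near x, `|a - 'D_v ('D_u f) y| < e.
  by move/cvgrPdist_lt: cuv; apply.
have near2 : \forall y \near x, `|b - 'D_u ('D_v f) y| < e.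
  by move/cvgrPdist_lt: cvu; apply.
have /nbhs_normP[d /= d0 dP] : \forall y \near x,
    `|a - 'D_v ('D_u f) y| < e /\ `|b - 'D_u ('D_v f) y| < e.
  by apply: filterS2 near1 near2 => y; split.
(* The summand 1 keeps the denominator positive when u = v = 0 and makes the estimate in [small]
   strict. *)
pose h := d / (`|u| + `|v| + 1).
have p0 : 0 < `|u| + `|v| + 1 by rewrite ltr_wpDl // addr_ge0.
have h0 : 0 < h by rewrite divr_gt0.
have small s t : 0 < s < h -> 0 < t < h -> `|x - (t *: v + (s *: u + x))| < d.
  move=> /andP[s0 sh] /andP[t0 th].
  rewrite addrA opprD addrCA subrr addr0 normrN (le_lt_trans (ler_normD _ _)) //.
  rewrite !normrZ !gtr0_norm //.
  have : t * `|v| + s * `|u| <= h * (`|u| + `|v|).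
    by rewrite mulrDr addrC lerD // ler_wpM2r // ltW.
  move=> /le_lt_trans; apply.
  by rewrite /h mulrAC ltr_pdivrMr // ltr_pM2l // ltrDl.
have [s [t [sh th E1]]] := second_difference x h0 dfu dfuv.
have [s' [t' [sh' th' E2]]] := second_difference x h0 dfv dfvu.
(* Both second differences are the same alternating sum of four values of f, and h is cancelled
   twice. *)
have E : 'D_v ('D_u f) (t *: v + (s *: u + x)) = 'D_u ('D_v f) (t' *: u + (s' *: v + x)).
  apply: (mulIf (lt0r_neq0 h0)); apply: (mulIf (lt0r_neq0 h0)).
  apply: etrans (esym E1) (etrans _ E2); rewrite [h *: v + (h *: u + x)]addrCA.
  have swap (p q r s0 : R) : p - q - (r - s0) = p - r - (q - s0) by ring.
  exact: swap.
have [n1 _] := dP _ (small _ _ sh th).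
have [_ n2] : `|a - 'D_v ('D_u f) (t' *: u + (s' *: v + x))| < e /\
   `|b - 'D_u ('D_v f) (t' *: u + (s' *: v + x))| < e.
  by apply: dP; rewrite /= addrCA; exact: small.
by rewrite E in n1; move: (dist_lt_double n1 n2); rewrite -splitr ltxx.
Qed.

End MixedDerivatives.

(** * Partial derivatives of Clifford-valued functions, coefficient by coefficient *)

Section PartialDerivatives.
Set Implicit Arguments. Unset Strict Implicit.
Local Open Scope classical_set_scope.
Variables (R : realType) (m : nat).
Notation pt := (pt R m).
Notation Cl := (Cl R m).
Implicit Types (f g : pt -> Cl) (k : 'I_m.+1) (X Y : pt) (j : 'I_m).

Definition coef f (A : {set 'I_m}) : pt -> R^o := fun X => f X A.
Definition basis_dir k : pt := delta_mx 0 k.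

Definition has_partials f := forall k A X, derivable (coef f A) X (basis_dir k).

Lemma partialE k f X A : partial k f X A = 'D_(basis_dir k) (coef f A) X.
Proof. by rewrite ffunE. Qed.

Lemma coef_partial k f A : coef (partial k f) A = 'D_(basis_dir k) (coef f A).
Proof. by apply/funext => X; rewrite /coef partialE. Qed.

Lemma coef_lin (c : R) f g A : coef (c *: f + g) A = c \*: coef f A + coef g A.
Proof. by apply/funext => X; rewrite /coef !ffunE. Qed.

Lemma has_partials_lin (c : R) f g :
  has_partials f -> has_partials g -> has_partials (c *: f + g).
Proof.
by move=> df dg k A X; rewrite coef_lin; apply: derivableD => //; exact: derivableZ.
Qed.

Lemma partial_lin k (c : R) f g : has_partials f -> has_partials g ->
  partial k (c *: f + g) = c *: partial k f + partial k g.
Proof.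
move=> df dg; apply/funext => X; apply/ffunP => A.
rewrite partialE coef_lin deriveD //; last exact: derivableZ.
by rewrite deriveZ // -!partialE !ffunE.
Qed.

Lemma coef_gen_act j f A :
  coef (gen_act j \o f) A = gen_sign R j (symd [set j] A) \*: coef f (symd [set j] A).
Proof. by apply/funext => X; rewrite /coef /= gen_actE. Qed.

Lemma has_partials_gen_act j f : has_partials f -> has_partials (gen_act j \o f).
Proof. by move=> df k A X; rewrite coef_gen_act; exact: derivableZ. Qed.

Lemma partial_gen_act k j f : has_partials f ->
  partial k (gen_act j \o f) = gen_act j \o partial k f.
Proof.
move=> df; apply/funext => X; apply/ffunP => A.
by rewrite partialE coef_gen_act deriveZ //= gen_actE partialE.
Qed.

Lemma smooth_has_partials f : smooth f -> has_partials f.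
Proof. by move=> sf k A X; have [_] := sf [::]; exact. Qed.

Lemma smooth_continuous f A : smooth f -> continuous (coef f A).
Proof. by move=> /(_ [::]) [cf _]; exact: cf. Qed.

Lemma smooth_foldr f s : smooth f -> smooth (foldr (@partial R m) f s).
Proof. by move=> sf s'; rewrite -foldr_cat; exact: sf. Qed.

Lemma smooth_partial k f : smooth f -> smooth (partial k f).
Proof. exact: (@smooth_foldr f [:: k]). Qed.

Lemma smoothP f : (forall s, has_partials (foldr (@partial R m) f s)) ->
  (forall s A, continuous (coef (foldr (@partial R m) f s) A)) -> smooth f.
Proof. by move=> df cf s; split=> [A|k X A]; [exact: cf|exact: df]. Qed.

Lemma foldr_partial_lin (c : R) f g s : smooth f -> smooth g ->
  foldr (@partial R m) (c *: f + g) s =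
  c *: foldr (@partial R m) f s + foldr (@partial R m) g s.
Proof.
move=> sf sg; elim: s => //= k s ->.
by rewrite partial_lin //; apply/smooth_has_partials/smooth_foldr.
Qed.

Lemma smooth_lin (c : R) f g : smooth f -> smooth g -> smooth (c *: f + g).
Proof.
move=> sf sg; apply: smoothP => s => [|A]; rewrite foldr_partial_lin //.
  by apply: has_partials_lin; apply/smooth_has_partials/smooth_foldr.
have [cf cg] : continuous (coef (foldr (@partial R m) f s) A) /\
    continuous (coef (foldr (@partial R m) g s) A).
  by split; apply/smooth_continuous/smooth_foldr.
by rewrite coef_lin => X; exact: cvgD (cvgZr (cf X)) (cg X).
Qed.

Lemma foldr_partial_gen_act j f s : smooth f ->
  foldr (@partial R m) (gen_act j \o f) s = gen_act j \o foldr (@partial R m) f s.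
Proof.
move=> sf; elim: s => //= k s ->.
by rewrite partial_gen_act //; apply/smooth_has_partials/smooth_foldr.
Qed.

Lemma smooth_gen_act j f : smooth f -> smooth (gen_act j \o f).
Proof.
move=> sf; apply: smoothP => s => [|A]; rewrite foldr_partial_gen_act //.
  by apply: has_partials_gen_act; apply/smooth_has_partials/smooth_foldr.
have cf := @smooth_continuous _ (symd [set j] A) (smooth_foldr s sf).
by rewrite coef_gen_act => X; exact: cvgZr (cf X).
Qed.

Lemma smooth0 : smooth (0 : pt -> Cl).
Proof.
have p0 s : foldr (@partial R m) 0 s = 0.
  elim: s => //= k s ->; apply/funext => X; apply/ffunP => A.
  rewrite partialE (_ : coef _ _ = cst 0) ?derive_cst ?ffunE //.
  by apply/funext => Y; rewrite /coef ffunE.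
have c0 A : coef 0 A = cst 0 by apply/funext => Y; rewrite /coef ffunE.
apply: smoothP => s => [k A X|A]; rewrite p0 c0; first exact: ex_derive.
exact: cst_continuous.
Qed.

Lemma partial_comm k l f : smooth f -> partial k (partial l f) = partial l (partial k f).
Proof.
move=> sf; apply/funext => X; apply/ffunP => A.
rewrite [LHS]partialE [RHS]partialE !coef_partial.
have df n Y : derivable (coef f A) Y (basis_dir n) by exact: smooth_has_partials.
have ddf n n' Y : derivable ('D_(basis_dir n) (coef f A)) Y (basis_dir n').
  by rewrite -coef_partial; apply/smooth_has_partials/smooth_partial.
have cf n n' : continuous ('D_(basis_dir n') ('D_(basis_dir n) (coef f A))).
  by rewrite -!coef_partial; apply/smooth_continuous/smooth_partial/smooth_partial.
exact: derive_comm (df l) (df k) (ddf l k) (ddf k l) (cf l k X) (cf k l X).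
Qed.

Lemma dep_shift f v X Y : depends_only_on_y f ->
    (forall k, (2 <= k)%N -> Defs.coord X k = Defs.coord Y k) ->
  f (v + X) = f (v + Y).
Proof. by move=> df XY; apply: df => k k2; rewrite /Defs.coord !mxE; congr (_ + _); exact: XY. Qed.

Lemma dep_partial k f : depends_only_on_y f -> depends_only_on_y (partial k f).
Proof.
move=> df X Y XY; apply/ffunP => A; rewrite !partialE.
congr (lim (_ @ 0^')); apply/funext => h /=.
by rewrite /coef (dep_shift _ df XY) (df _ _ XY).
Qed.

(** Moving x_0 or x_1 fixes all coordinates of index at least 2, so the difference quotient is that
    of a constant. *)
Lemma partial_dep0 k f : (k < 2)%N -> depends_only_on_y f -> partial k f = 0.
Proof.
move=> k2 df; apply/funext => X; apply/ffunP => A; rewrite partialE [RHS]ffunE.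
rewrite -(derive_cst (f X A : R^o) X (basis_dir k)).
congr (lim (_ @ 0^')); apply/funext => h /=; congr (_ *: (_ - _)).
rewrite /coef (df _ X) // => l l2; rewrite /Defs.coord !mxE eqxx /=.
by rewrite (_ : (l == k) = false) ?mulr0 ?add0r //; apply/eqP => lk; move: l2; rewrite lk leqNgt k2.
Qed.

(** Both derivatives are limits of one and the same difference quotient; this reduces derivatives in
    x_0 and x_1 to one-variable calculus. *)
Lemma is_derive_along (V : normedModType R) (phi : pt -> R^o) (psi : V -> R^o) X v t w d :
    (forall h : R, phi (h *: v + X) = psi (h *: w + t)) ->
  is_derive t w psi d -> is_derive X v phi d.
Proof.
move=> E; have E0 : phi X = psi t by have := E 0; rewrite !scale0r !add0r.
have EE : (fun h : R => h^-1 *: ((phi \o shift X) (h *: v) - phi X)) =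
          (fun h => h^-1 *: ((psi \o shift t) (h *: w) - psi t)).
  by apply/funext => h /=; rewrite E E0.
by case=> dt dE; split; rewrite /derivable /derive /= EE.
Qed.

Definition scale_fun (phi : pt -> R^o) f : pt -> Cl := fun X => phi X *: f X.

Lemma coef_scale_fun phi f A : coef (scale_fun phi f) A = phi * coef f A.
Proof. by apply/funext => X; rewrite /coef /scale_fun ffunE. Qed.

Lemma has_partials_scale phi f : (forall k X, derivable phi X (basis_dir k)) ->
  has_partials f -> has_partials (scale_fun phi f).
Proof. by move=> dp df k A X; rewrite coef_scale_fun; apply: derivableM. Qed.

Lemma partial_scale k phi d f X : is_derive X (basis_dir k) phi d -> has_partials f ->
  partial k (scale_fun phi f) X = d *: f X + phi X *: partial k f X.
Proof.
move=> dp df; apply/ffunP => A; rewrite partialE coef_scale_fun deriveM //.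
by rewrite derive_val !ffunE addrC; congr (_ + _); exact: mulrC.
Qed.

End PartialDerivatives.

(** * The space of smooth functions of y and its Dirac operator *)

Section SmoothFunctionsOfY.
Set Implicit Arguments. Unset Strict Implicit.
Variables (R : realType) (m : nat).
Notation pt := (pt R m).
Notation Cl := (Cl R m).

Definition ysmooth : {pred pt -> Cl} :=
  fun f => `[< smooth f /\ depends_only_on_y f >].

Fact ysmooth_submod_closed : submod_closed ysmooth.
Proof.
split=> [|c f g]; rewrite ?/(_ \in ysmooth).
  by apply/asboolP; split; [exact: smooth0|move=> X Y _].
move=> /asboolP[sf yf] /asboolP[sg yg]; apply/asboolP; split; first exact: smooth_lin.
by move=> X Y XY; rewrite -[LHS]/(c *: f X + g X) (yf _ _ XY) (yg _ _ XY).
Qed.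
HB.instance Definition _ :=
  GRing.isSubmodClosed.Build R (pt -> Cl) ysmooth ysmooth_submod_closed.

(** Bundling smoothness gives a vector space on which D is a linear endomorphism, as the results on
    [quad_step] require. *)
Record yfun := YFun { yval :> pt -> Cl; yvalP : yval \in ysmooth }.
HB.instance Definition _ := [isSub for yval].
HB.instance Definition _ := [Choice of yfun by <:].
HB.instance Definition _ := [SubChoice_isSubLmodule of yfun by <:].

Implicit Types (f g : yfun) (j : 'I_m) (X : pt).

Lemma yfun_smooth f : smooth f.
Proof. by case: f => f /= /asboolP[]. Qed.

Lemma yfun_dep f : depends_only_on_y f.
Proof. by case: f => f /= /asboolP[]. Qed.

Lemma yfun_partials f : has_partials f.
Proof. exact/smooth_has_partials/yfun_smooth. Qed.

Lemma yfun_eqP f g : f = g <-> forall X, f X = g X.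
Proof. by split=> [-> //|fg]; apply/val_inj/funext. Qed.

Lemma yfunP (h : pt -> Cl) : smooth h -> depends_only_on_y h -> h \in ysmooth.
Proof. by move=> sh yh; apply/asboolP. Qed.

Lemma smooth_sum I (r : seq I) (P : pred I) (F : I -> pt -> Cl) :
  (forall i, P i -> smooth (F i)) -> smooth (\sum_(i <- r | P i) F i).
Proof.
move=> sF; apply: (big_ind (@smooth R m)); [exact: smooth0| |exact: sF].
by move=> f g sf sg; rewrite -[f]scale1r; exact: smooth_lin.
Qed.

Lemma partial_sum k I (r : seq I) (P : pred I) (F : I -> pt -> Cl) :
    (forall i, P i -> has_partials (F i)) ->
  partial k (\sum_(i <- r | P i) F i) = \sum_(i <- r | P i) partial k (F i).
Proof.
move=> dF; have d0 := smooth_has_partials (@smooth0 R m).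
(* The induction also carries differentiability, which additivity of the derivative needs at each
   step. *)
suff [] : has_partials (\sum_(i <- r | P i) F i) /\
  partial k (\sum_(i <- r | P i) F i) = \sum_(i <- r | P i) partial k (F i) by [].
elim/big_ind2 : _ => [|f f' g g' [df <-] [dg <-]|i Pi].
(* Linearity on - 1 times 0 plus 0 gives the derivative of 0 as a vector minus itself. *)
- split=> //; move: (partial_lin k (- 1) d0 d0).
  by rewrite scaler0 addr0 scaleN1r addNr.
- by move: (@has_partials_lin _ _ 1 _ _ df dg) (@partial_lin _ _ k 1 _ _ df dg); rewrite !scale1r.
- by split; [exact: dF|].
Qed.

Lemma diracyE (h : pt -> Cl) :
  diracy h = \sum_(j < m | (0 < j)%N) (gen_act j \o partial (xi j) h).
Proof. by apply/funext => X; rewrite fct_sumE. Qed.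

Fact diracy_ysmooth f : diracy f \in ysmooth.
Proof.
apply: yfunP.
  rewrite diracyE; apply: smooth_sum => j _.
  exact/smooth_gen_act/smooth_partial/yfun_smooth.
move=> X Y XY; apply: eq_bigr => j _.
by rewrite (dep_partial (xi j) (yfun_dep f) XY).
Qed.
Definition ydirac f := YFun (diracy_ysmooth f).

Fact ydirac_is_linear : linear ydirac.
Proof.
move=> c f g; apply/yfun_eqP => X.
rewrite -[RHS]/(c *: diracy f X + diracy g X) .
rewrite -[LHS]/(diracy (c *: (f : pt -> Cl) + g) X) /diracy.
rewrite scaler_sumr -big_split; apply: eq_bigr => j _ /=.
by rewrite partial_lin; [exact: (linearP (gen_act j))|exact: yfun_partials|exact: yfun_partials].
Qed.
HB.instance Definition _ :=
  GRing.isLinear.Build R yfun yfun *:%R ydirac ydirac_is_linear.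

Fact gen_act_ysmooth j f : gen_act j \o f \in ysmooth.
Proof.
apply: yfunP; first exact/smooth_gen_act/yfun_smooth.
by move=> X Y XY; rewrite /= (yfun_dep f XY).
Qed.
Definition ygen_act j f := YFun (gen_act_ysmooth j f).

Fact ygen_act_is_linear j : linear (ygen_act j).
Proof. by move=> c f g; apply/yfun_eqP => X /=; rewrite linearP. Qed.
HB.instance Definition _ j :=
  GRing.isLinear.Build R yfun yfun *:%R (ygen_act j) (ygen_act_is_linear j).

Lemma ygen_actK j f : ygen_act j (ygen_act j f) = - f.
Proof. by apply/yfun_eqP => X /=; rewrite gen_actK. Qed.

(** Index 0 stands for e_1, which commutes with partial derivatives and anticommutes with every
    generator occurring in D. *)
Lemma ydirac_gen_act j f : (j : nat) = 0%N -> ydirac (ygen_act j f) = - ygen_act j (ydirac f).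
Proof.
move=> j0; apply/yfun_eqP => X /=; rewrite -[RHS]/(- gen_act j (diracy f X)) /diracy.
rewrite linear_sum -sumrN; apply: eq_bigr => i i0.
rewrite partial_gen_act; last exact: yfun_partials.
by rewrite -/(gen_act i _) /= gen_actC // -val_eqE /= j0 -lt0n.
Qed.

Lemma lapyE f : lapy f = - (ydirac (ydirac f) : pt -> Cl).
Proof.
pose M X i j : Cl := gen_act i (gen_act j (partial (xi i) (partial (xi j) f) X)).
apply/funext => X; rewrite -[RHS]/(- diracy (diracy f) X).
have -> : diracy (diracy f) X =
    \sum_(i < m | (0 < i)%N) \sum_(j < m | (0 < j)%N) M X i j.
  apply: eq_bigr => i _; rewrite diracyE -linear_sum /=; congr (clmul _ _).
  rewrite partial_sum ?fct_sumE => [|j _].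
    apply: eq_bigr => j _; rewrite partial_gen_act //.
    exact/smooth_has_partials/smooth_partial/yfun_smooth.
  by apply/has_partials_gen_act/smooth_has_partials/smooth_partial/yfun_smooth.
have n2 : (2 : R) != 0 by rewrite pnatr_eq0.
(* Off the diagonal, M i j + M j i = 0. *)
apply: (scalerI n2); rewrite [RHS]scalerN [X in _ = - X]scaler_nat [X in _ = - X]mulr2n.
(* Exchanging the summations in one copy of the doubled sum pairs M i j with M j i. *)
rewrite [X in X + _]exchange_big -big_split /= scaler_sumr -sumrN; apply: eq_bigr => i i0.
rewrite -big_split /= (bigD1 i) //= big1 ?addr0 => [|j /andP[j0 ji]].
  by rewrite /M gen_actK scaler_nat mulr2n opprD !opprK.
by rewrite /M gen_actC // (partial_comm _ _ (yfun_smooth f)) addNr.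
Qed.

End SmoothFunctionsOfY.

(** * Trigonometric sums *)

Section Trigonometric.
Set Implicit Arguments. Unset Strict Implicit.
Variables (R : realType) (m : nat) (m_gt0 : (0 < m)%N).
Notation pt := (pt R m).
Notation Cl := (Cl R m).
Notation yfun := (yfun R m).
Notation o := (Ordinal m_gt0).
Notation D := (@ydirac R m).
Notation L := (@ygen_act R m o).
Implicit Types (X : pt) (f : yfun) (g e : R -> R) (j : 'I_m).

Lemma is_derive_expRN (x : R) : is_derive x 1 (fun t => expR (- t)) (- expR (- x)).
Proof.
have E : (fun t : R => expR (- t)) = (fun t => (expR t)^-1).
  by apply/funext => t; rewrite expRN.
have ne : expR x != 0 by rewrite gt_eqF ?expR_gt0.
have dx : derivable (@expR R) x 1 by exact: ex_derive.
rewrite E; split; first exact: derivableV.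
rewrite deriveV // derive_val expRN /GRing.scale /=; field; exact: ne.
Qed.

Lemma is_derive_coshR (x : R) : is_derive x 1 (@coshR R) (sinhR x).
Proof.
have d1 := is_derive_expR x; have d2 := is_derive_expRN x.
have E : @coshR R = 2^-1 \*: (@expR R + (fun t => expR (- t))).
  by apply/funext => t; rewrite /coshR /= mulrC.
by rewrite E; apply: is_derive_eq; rewrite /sinhR mulrC.
Qed.

Lemma is_derive_sinhR (x : R) : is_derive x 1 (@sinhR R) (coshR x).
Proof.
have d1 := is_derive_expR x; have d2 := is_derive_expRN x.
have E : @sinhR R = 2^-1 \*: (@expR R - (fun t => expR (- t))).
  by apply/funext => t; rewrite /sinhR /= mulrC.
by rewrite E; apply: is_derive_eq; rewrite /coshR mulrC opprK.
Qed.

Definition sep g e : pt -> R^o :=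
  fun X => g (Defs.coord X ord0) * e (Defs.coord X (xi o)).

Lemma coord_line (k l : 'I_m.+1) (t : R) X :
  Defs.coord (t *: basis_dir R k + X) l = t *+ (l == k) + Defs.coord X l.
Proof. by rewrite /Defs.coord !mxE eqxx /= mulr_natr. Qed.

Lemma is_derive_sep0 g e d X : is_derive (Defs.coord X ord0) 1 g d ->
  is_derive X (basis_dir R ord0) (sep g e) (d * e (Defs.coord X (xi o))).
Proof.
move=> dg; set c := e _.
apply: (@is_derive_along _ _ _ _ (c \*: (g : R -> R^o)) _ _ (Defs.coord X ord0) 1).
  by move=> t; rewrite /sep !coord_line /= [_%:A]mulr1 mulr1n add0r mulrC.
by apply: is_derive_eq; rewrite mulrC.
Qed.

Lemma is_derive_sep1 g e d X : is_derive (Defs.coord X (xi o)) 1 e d ->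
  is_derive X (basis_dir R (xi o)) (sep g e) (g (Defs.coord X ord0) * d).
Proof.
move=> de; set c := g _.
apply: (@is_derive_along _ _ _ _ (c \*: (e : R -> R^o)) _ _ (Defs.coord X (xi o)) 1).
  by move=> t; rewrite /sep !coord_line eqxx /= [_%:A]mulr1 mulr1n add0r.
Qed.

Lemma is_derive_sep_other g e j X : j != o -> is_derive X (basis_dir R (xi j)) (sep g e) 0.
Proof.
move=> jo; apply: (@is_derive_along _ _ R _ (cst (sep g e X)) _ _ 0 1) => t.
by rewrite /sep !coord_line (inj_eq lift_inj) [_ == j]eq_sym (negPf jo) /= !add0r.
Qed.

Definition has_gradient01 (phi phi0 phi1 : pt -> R^o) := forall X,
  [/\ is_derive X (basis_dir R ord0) phi (phi0 X),
      is_derive X (basis_dir R (xi o)) phi (phi1 X) &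
      forall j, j != o -> is_derive X (basis_dir R (xi j)) phi 0].

Lemma gradient_sep g g' e e' :
    (forall x : R, is_derive x 1 g (g' x)) -> (forall x : R, is_derive x 1 e (e' x)) ->
  has_gradient01 (sep g e) (sep g' e) (sep g e').
Proof.
move=> dg de X; split; [exact: is_derive_sep0|exact: is_derive_sep1|].
by move=> j; exact: is_derive_sep_other.
Qed.

Lemma has_partials_scale_gradient phi phi0 phi1 f :
  has_gradient01 phi phi0 phi1 -> has_partials (scale_fun phi f).
Proof.
move=> dphi; apply: has_partials_scale => [k X|]; last exact: yfun_partials.
have [d0 d1 dj] := dphi X.
case: (unliftP ord0 k) => [j ->|->]; last by case: d0.
have [->|jo] := eqVneq j o; first by case: d1.
by case: (dj j jo).
Qed.

Lemma diracX_lin (c : R) (u v : pt -> Cl) : has_partials u -> has_partials v ->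
  diracX (c *: u + v) = c *: diracX u + diracX v.
Proof.
move=> du dv; apply/funext => X; rewrite -[RHS]/(c *: diracX u X + diracX v X).
rewrite /diracX partial_lin // scalerDr addrACA; congr (_ + _).
rewrite scaler_sumr -big_split; apply: eq_bigr => j _ /=.
by rewrite partial_lin //; exact: (linearP (gen_act j)).
Qed.

Lemma has_partialsD (u v : pt -> Cl) :
  has_partials u -> has_partials v -> has_partials (u + v).
Proof. by move=> du dv; rewrite -[u]scale1r; exact: has_partials_lin. Qed.

Lemma diracXD (u v : pt -> Cl) : has_partials u -> has_partials v ->
  diracX (u + v) = diracX u + diracX v.
Proof. by move=> du dv; rewrite -[u]scale1r diracX_lin // !scale1r. Qed.

(** In the product rule, x_0 and x_1 differentiate only phi and the remaining variables only f; real
    factors commute with the generators. *)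
Lemma diracX_scale phi phi0 phi1 f X : has_gradient01 phi phi0 phi1 ->
  diracX (scale_fun phi f) X = phi0 X *: f X + phi1 X *: L f X + phi X *: D f X.
Proof.
move=> /(_ X)[dp0 dp1 dpj].
have df := @yfun_partials _ _ f; have yf := @yfun_dep _ _ f.
rewrite /diracX (partial_scale dp0) // (partial_dep0 _ yf) // -addrA.
rewrite -[(0 : pt -> Cl) X]/(0 : Cl) scaler0 add0r -addrA; congr (_ + _).
rewrite (bigD1 o) //= (partial_scale dp1) // (partial_dep0 _ yf) //.
rewrite -[(0 : pt -> Cl) X]/(0 : Cl) scaler0 addr0.
congr (_ + _); first exact: (linearZ_LR (gen_act o)).
rewrite /diracy scaler_sumr; apply: eq_big => [j|j jo]; first by rewrite lt0n.
rewrite (partial_scale (dpj j jo)) // scale0r add0r.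
exact: (linearZ_LR (gen_act j)).
Qed.

(** The span of these four products is stable under derivation in x_0 and x_1. All scalars are real,
    and e_1 is absorbed into the coefficients. *)
Definition trig_sum (P Q S T : yfun) : pt -> Cl :=
  scale_fun (sep cos (@coshR R)) P + scale_fun (sep sin (@coshR R)) Q
  + (scale_fun (sep sin (@sinhR R)) S + scale_fun (sep cos (@sinhR R)) T).

(** Here a, b, c, d stand for cos cosh, sin cosh, sin sinh, cos sinh, and the prefixes l and d for
    the images under L and D. *)
Lemma trig_regroup (a b c d : R) (p lp dp q lq dq s ls ds t lt dt : Cl) :
    - b *: p + d *: lp + a *: dp + (a *: q + c *: lq + b *: dq)
    + (d *: s + b *: ls + c *: ds + (- c *: t + a *: lt + d *: dt)) =
  a *: (dp + q + lt) + b *: (dq - p + ls) + (c *: (ds - t + lq) + d *: (dt + s + lp)).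
Proof. by apply/ffunP => A; rewrite !ffunE /GRing.scale /=; ring. Qed.

Lemma diracX_trig_sum P Q S T : diracX (trig_sum P Q S T) =
  trig_sum (D P + Q + L T) (D Q - P + L S) (D S - T + L Q) (D T + S + L P).
Proof.
have gcc := gradient_sep (@is_derive_cos R) is_derive_coshR.
have gsc := gradient_sep (@is_derive_sin R) is_derive_coshR.
have gss := gradient_sep (@is_derive_sin R) is_derive_sinhR.
have gcs := gradient_sep (@is_derive_cos R) is_derive_sinhR.
have hcc := @has_partials_scale_gradient _ _ _ P gcc.
have hsc := @has_partials_scale_gradient _ _ _ Q gsc.
have hss := @has_partials_scale_gradient _ _ _ S gss.
have hcs := @has_partials_scale_gradient _ _ _ T gcs.
have E : diracX (trig_sum P Q S T) =
    (diracX (scale_fun (sep cos (@coshR R)) P) + diracX (scale_fun (sep sin (@coshR R)) Q))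
  + (diracX (scale_fun (sep sin (@sinhR R)) S) + diracX (scale_fun (sep cos (@sinhR R)) T)).
  apply: etrans (diracXD (has_partialsD hcc hsc) (has_partialsD hss hcs)) _.
  by rewrite (diracXD hcc hsc) (diracXD hss hcs).
apply/funext => X; rewrite E.
apply: etrans (trig_regroup _ _ _ _ _ _ _ _ _ _ _ _ _ _ _ _).
congr ((_ + _) + (_ + _)).
- by apply: etrans (diracX_scale _ _ gcc) _; rewrite {1}/sep mulNr.
- exact: diracX_scale gsc.
- exact: diracX_scale gss.
- by apply: etrans (diracX_scale _ _ gcs) _; rewrite {1}/sep mulNr.
Qed.

(** The coefficients do not depend on (x_0, x_1), which can thus be set freely: (0, 0), (pi/2, 0),
    (pi/2, 1) and (0, 1) isolate P, Q, S and T in turn, as sinh 1 is nonzero. *)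
Lemma trig_sum_eq0 P Q S T : trig_sum P Q S T = 0 -> [/\ P = 0, Q = 0, S = 0 & T = 0].
Proof.
move=> F0.
have ev (r s : R) X : (cos r * coshR s) *: P X + (sin r * coshR s) *: Q X
    + ((sin r * sinhR s) *: S X + (cos r * sinhR s) *: T X) = 0.
  pose X' : pt := \row_k (if k == ord0 then r else if k == xi o then s else X ord0 k).
  have X'X (f : yfun) : f X' = f X.
    apply: yfun_dep => k k2; rewrite /Defs.coord mxE.
    by case: eqP k2 => [->|_] //; case: eqP => [->|].
  have := congr1 (fun u : pt -> Cl => u X') F0; rewrite -[RHS]/(0 : Cl) => <-.
  rewrite /trig_sum -[RHS]/((_ *: P X' + _ *: Q X') + (_ *: S X' + _ *: T X')) !X'X.
  by rewrite /sep /Defs.coord !mxE eqxx.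
have ch0 : coshR (0 : R) = 1 by rewrite /coshR oppr0 expR0 divff ?pnatr_eq0.
have sh0 : sinhR (0 : R) = 0 by rewrite /sinhR oppr0 subrr mul0r.
have sh1 : sinhR (1 : R) != 0.
  by rewrite mulf_neq0 ?invr_eq0 ?pnatr_eq0 // subr_eq0 (inj_eq expR_inj) gt_eqF // ltrN10.
have P0 : P = 0.
  apply/yfun_eqP => X; have := ev 0 0 X.
  by rewrite cos0 sin0 ch0 sh0 !mul0r mulr0 mulr1 !scale0r scale1r !addr0.
have Q0 : Q = 0.
  apply/yfun_eqP => X; have := ev (pi / 2) 0 X.
  by rewrite cos_pihalf sin_pihalf ch0 sh0 !mul0r mulr0 mulr1 !scale0r scale1r !addr0 add0r.
have yfun0 X : (0 : yfun) X = 0 by [].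
split=> //; apply/yfun_eqP => X.
  have := ev (pi / 2) 1 X; rewrite P0 Q0 !yfun0 !scaler0 !add0r.
  rewrite cos_pihalf sin_pihalf !mul0r mul1r scale0r addr0 => /eqP.
  by rewrite scaler_eq0 (negPf sh1) => /eqP.
have := ev 0 1 X; rewrite P0 Q0 !yfun0 !scaler0 !add0r.
rewrite cos0 sin0 !mul0r mul1r scale0r add0r => /eqP.
by rewrite scaler_eq0 (negPf sh1) => /eqP.
Qed.

(** The function F: cos z, sin z and their conjugates are expanded in real and e_1 parts, with e_1
    moved onto the coefficients. *)
Definition trig_quad (w : quad yfun) : pt -> Cl :=
  let: (a1, b1, a2, b2) := w in
  trig_sum (a1 + a2) (b1 + b2) (L (a2 - a1)) (L (b1 - b2)).

Lemma trig_quadE a1 b1 a2 b2 X : trig_quad (a1, b1, a2, b2) X =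
  clmul (cos_z m_gt0 X) (a1 X) + clmul (sin_z m_gt0 X) (b1 X)
  + clmul (cos_zbar m_gt0 X) (a2 X) + clmul (sin_zbar m_gt0 X) (b2 X).
Proof.
rewrite /cos_z /sin_z /cos_zbar /sin_zbar !clmul_clcplx /trig_quad /trig_sum.
rewrite -[LHS]/((_ *: (a1 X + a2 X) + _ *: (b1 X + b2 X))
  + (_ *: gen_act o (a2 X - a1 X) + _ *: gen_act o (b1 X - b2 X))) !linearB /=.
move: (gen_act o (a1 X)) (gen_act o (a2 X)) (gen_act o (b1 X)) (gen_act o (b2 X)).
move: (a1 X) (a2 X) (b1 X) (b2 X) => p q r s lp lq lr ls; rewrite /sep.
by apply/ffunP => A; rewrite !ffunE /GRing.scale /=; ring.
Qed.

(** The swap of the two pairs comes from D e_1 = - e_1 D. The terms 2 B2 and - 2 A2 come from the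
    conjugate functions: the (x_0, x_1) part of the operator kills cos z and sin z, but not cos and
    sin of the conjugate. *)
Lemma diracX_trig_quad w : diracX (trig_quad w) = trig_quad (quad_step D w).
Proof.
case: w => [[[a1 b1] a2] b2]; rewrite /trig_quad /quad_step diracX_trig_sum.
have dbl f : 2 *: f = f + f by rewrite scaler_nat mulr2n.
have DL f : D (L f) = L (- D f) by rewrite ydirac_gen_act // linearN.
rewrite !dbl !DL; congr trig_sum.
- rewrite ygen_actK opprB linearD -!addrA addrCA; congr (_ + (_ + _)).
  by rewrite addrCA subrKC.
- rewrite ygen_actK opprB linearD [- (a1 + a2)]opprD -addrA.
  by rewrite [X in _ + X]addrACA addNr add0r -opprD -addrA addrCA.
- rewrite -linearB -linearD; congr (L _).
  rewrite linearB opprB opprB -!addrA; congr (_ + _).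
  by rewrite addKr addrC -addrA.
- rewrite -!linearD; congr (L _).
  by rewrite linearB !opprB -!addrA; congr (_ + _); rewrite addKr addrC -addrA.
Qed.

Lemma iter_diracX_trig_quad n w :
  iter n (@diracX R m) (trig_quad w) = trig_quad (iter n (quad_step D) w).
Proof. by elim: n => //= n ->; rewrite diracX_trig_quad. Qed.

(** By [trig_sum_eq0] the sums vanish, and so do the differences because L^2 = -1 makes L injective;
    then 2 is cancelled. *)
Lemma trig_quad_eq0 w : trig_quad w = 0 <-> w = (0, 0, 0, 0).
Proof.
have L0 f : L f = 0 -> f = 0.
  by move=> /(congr1 L); rewrite ygen_actK linear0 => /eqP; rewrite oppr_eq0 => /eqP.
case: w => [[[a1 b1] a2] b2]; split=> [/trig_sum_eq0[]|[-> -> -> ->]].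
  move=> + + /L0/eqP + /L0/eqP; rewrite !subr_eq0 => ea eb /eqP aE /eqP bE.
  have n2 : (2 : R) != 0 by rewrite pnatr_eq0.
  have dbl f : f + f = 0 -> f = 0.
    by move/eqP; rewrite -mulr2n -scaler_nat scaler_eq0 (negPf n2) => /eqP.
  by move: ea eb; rewrite aE bE => /dbl -> /dbl ->.
rewrite /= !subrr !addr0 linear0; apply/funext => X.
rewrite -[LHS]/((_ *: (0 : Cl) + _ *: (0 : Cl)) + (_ *: (0 : Cl) + _ *: (0 : Cl))).
by rewrite !scaler0 !addr0.
Qed.

End Trigonometric.

(** * Translation back to the Laplacian and the explicit sums *)

Section Conclusion.
Set Implicit Arguments. Unset Strict Implicit.
Variables (R : realType) (m : nat).

Lemma iter_lapy n (f : yfun R m) :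
  iter n (@lapy R m) f = ((-1) ^+ n *: iter n.*2 (@ydirac R m) f : yfun R m).
Proof.
elim: n f => [|n IH] f; first by rewrite scale1r.
rewrite iterSr lapyE -[- _]/(yval (- ydirac (ydirac f))) IH doubleS !iterSr.
by rewrite -[- ydirac _]scaleN1r iter_linearZ scalerA -exprSr.
Qed.

Lemma iter_ydirac n (f : yfun R m) :
  iter n (@ydirac R m) f = iter n (@diracy R m) f :> (pt R m -> Cl R m).
Proof. by elim: n => //= n ->. Qed.

Lemma polyact_slope_poly n (f : yfun R m) X :
  polyact (@ydirac R m) (slope_poly R n) f X =
  \sum_(1 <= k < n.+1) ((-1) ^+ k * ccoef R k) *: iter (k.*2.-1) (@diracy R m) f X.
Proof.
rewrite /slope_poly polyact_suml.
have yval_sum (r : seq nat) (G : nat -> yfun R m) :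
    (\sum_(k <- r) G k : yfun R m) X = \sum_(k <- r) G k X.
  by elim: r => [|k r IH]; rewrite ?big_nil // !big_cons -IH.
rewrite yval_sum; apply: eq_bigr => k _.
by rewrite polyactZl polyactXn -iter_ydirac.
Qed.

End Conclusion.

Theorem theorem5 (R : realType) (m : nat) (hm : (2 <= m)%N) (n : nat) (hn : (1 <= n)%N)
  (A1 B1 A2 B2 : pt R m -> Cl R m) :
  smooth A1 -> smooth B1 -> smooth A2 -> smooth B2 ->
  depends_only_on_y A1 -> depends_only_on_y B1 ->
  depends_only_on_y A2 -> depends_only_on_y B2 ->
  let h : (0 < m)%N := ltnW hm in
  let F : pt R m -> Cl R m := fun X =>
      clmul (cos_z h X) (A1 X) + clmul (sin_z h X) (B1 X)
    + clmul (cos_zbar h X) (A2 X) + clmul (sin_zbar h X) (B2 X) in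
  (forall X, iter n (@diracX R m) F X = 0) <->
  [/\ forall X, iter n (@lapy R m) A1 X = 0,
      forall X, iter n (@lapy R m) B1 X = 0,
      forall X, A2 X = \sum_(1 <= k < n.+1)
                  ((-1) ^+ k * @ccoef R k) *: iter (k.*2.-1) (@diracy R m) B1 X &
      forall X, B2 X = \sum_(1 <= k < n.+1)
                  ((-1) ^+ k.+1 * @ccoef R k) *: iter (k.*2.-1) (@diracy R m) A1 X].
Proof.
move=> sA1 sB1 sA2 sB2 yA1 yB1 yA2 yB2 h F.
pose a1 := YFun (yfunP sA1 yA1); pose b1 := YFun (yfunP sB1 yB1).
pose a2 := YFun (yfunP sA2 yA2); pose b2 := YFun (yfunP sB2 yB2).
have FE : F = trig_quad h (a1, b1, a2, b2) by apply/funext => X; rewrite trig_quadE.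
(* The two operators differ by the sign (-1)^n, so their kernels agree. *)
have DnE (f : yfun R m) : iter n.*2 (@ydirac R m) f = 0 <->
    forall X, iter n (@lapy R m) f X = 0.
  rewrite iter_lapy; split=> [-> X|f0]; first by rewrite scaler0.
  have /eqP : (-1) ^+ n *: iter n.*2 (@ydirac R m) f = 0 by apply/yfun_eqP.
  by rewrite scaler_eq0 signr_eq0 => /eqP.
have a2E : a2 = polyact (@ydirac R m) (slope_poly R n) b1 <->
    forall X, A2 X = \sum_(1 <= k < n.+1)
      ((-1) ^+ k * @ccoef R k) *: iter (k.*2.-1) (@diracy R m) B1 X.
  rewrite yfun_eqP; split=> e X; apply: etrans (e X) _; last apply: esym.
    exact: (polyact_slope_poly n b1 X).
  exact: (polyact_slope_poly n b1 X).
have b2E : b2 = - polyact (@ydirac R m) (slope_poly R n) a1 <->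
    forall X, B2 X = \sum_(1 <= k < n.+1)
      ((-1) ^+ k.+1 * @ccoef R k) *: iter (k.*2.-1) (@diracy R m) A1 X.
  (* The minus sign in front of P(D) A1 turns (-1)^k into (-1)^(k+1). *)
  have sumE X : \sum_(1 <= k < n.+1)
      ((-1) ^+ k.+1 * @ccoef R k) *: iter (k.*2.-1) (@diracy R m) A1 X =
      (- polyact (@ydirac R m) (slope_poly R n) a1 : yfun R m) X.
    rewrite -[RHS]/(- polyact (@ydirac R m) (slope_poly R n) a1 X) (polyact_slope_poly n a1).
    by rewrite -sumrN; apply: eq_bigr => k _; rewrite exprS mulN1r mulNr scaleNr.
  by rewrite yfun_eqP; split=> e X; apply: etrans (e X) _; rewrite sumE.
rewrite FE iter_diracX_trig_quad.
have -> : (forall X, trig_quad h (iter n (quad_step (@ydirac R m)) (a1, b1, a2, b2)) X = 0) <->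
    iter n (quad_step (@ydirac R m)) (a1, b1, a2, b2) = (0, 0, 0, 0).
  by rewrite -(trig_quad_eq0 h); split=> [e|-> //]; apply/funext.
(* The abstract criterion is applied with P = [slope_poly R n], whose quadratic congruence is
   [slope_polyP]. *)
rewrite (quad_step_nilpotent _ hn (slope_polyP R hn)).
by split=> -[/(DnE a1) ? /(DnE b1) ? /a2E ? /b2E ?]; split.
Qed.
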